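(* Let $k$ be a field, let $N$ be a positive integer, and let $q\in k$ be a non-trivial $N$-th root of unity. Let $M_i^u$ and $M_j^v$ be indecomposable $N$-complexes ($i,j\in\mathbb{Z}$, $0\le u,v\le N-1$). Then: if $u+v\le N-1$ we have $$M_i^u\otimes M_j^v\cong\bigoplus_{l=0}^{\min(u,v)}M_{i+j+l}^{u+v-2l};$$ if $u+v=e+N-1$ with $e\ge0$ we have $$M_i^u\otimes M_j^v\cong\bigoplus_{l=0}^{e}M_{i+j+l}^{N-1}\ \oplus\ \bigoplus_{l=e+1}^{\min(u,v)}M_{i+j+l}^{u+v-2l}.$$
   Context: An $N$-complex is a $\mathbb{Z}$-graded $k$-vector space $\{{}_iM\}_{i\in\mathbb{Z}}$ together with linear maps $d_i:{}_iM\to{}_{i+1}M$ such that $d_{i+N-1}\circ\dots\circ d_i=0$ for each $i\in\mathbb{Z}$. Morphisms are degree-preserving linear maps commuting with the $d_i$. For $i\in\mathbb{Z}$ and $0\le l\le N-1$, $M_i^l$ is the indecomposable $N$-complex with ${}_j(M_i^l)=k$ for $i\le j\le i+l$ and ${}_j(M_i^l)=0$ otherwise, where $d_i,\dots,d_{i+l-1}$ are the identity and all other $d_j$ are zero. The tensor product of $N$-complexes $M$ and $M'$ (depending on $q$) is the $N$-complex $M\otimes M'$ given by $${}_i(M\otimes M')=\bigoplus_{j+r=i}({}_jM\otimes_k{}_rM'),\qquad d_i(m_j\otimes m'_r)=m_j\otimes d_rm'_r+q^r\,d_jm_j\otimes m'_r$$ for $m_j\in{}_jM$, $m'_r\in{}_rM'$,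 $j+r=i$. An empty direct sum is zero.
   Formalization: ''Non-trivial N-th root of unity'' is taken to mean a primitive N-th root of unity with q ≠ 1; for merely q^N = 1, q ≠ 1 the claim fails (e.g. N = 4, q = −1, char k ≠ 2, u = v = 1, where d² = 0 on the tensor product). *)

(* Defs.v *)
From HB Require Import structures.
From mathcomp Require Import all_boot all_order all_algebra.
From mathcomp Require Import ring_quotient generic_quotient.
From mathcomp Require Import boolp freeg.

Set Implicit Arguments.
Unset Strict Implicit.
Unset Printing Implicit Defensive.

Import GRing.Theory.
Local Open Scope ring_scope.
Local Open Scope quotient_scope.

(* The condition that N consecutive differentials compose to zero is the      *)
(* separate predicate [is_ncomplex], so that the tensor product and the       *)
(* M_i^l are defined for all data; isomorphisms [ncomplex_iso] are between    *)
(* N-complexes only.                                                          *)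
Record gcomplex (k : fieldType) := GComplex {
  gr :> int -> lmodType k;
  diff : forall i : int, {linear gr i -> gr (i + 1)}
}.

(* [diffn X n i] is d_{i+n-1} o ... o d_i; its codomain is the degree         *)
(* i + 1 + ... + 1, which is only propositionally equal to i + n.             *)
Fixpoint diffn (k : fieldType) (X : gcomplex k) (n : nat) (i : int) :
    X i -> X (iter n (fun j => j + 1) i) :=
  match n return X i -> X (iter n (fun j => j + 1) i) with
  | 0%N => id
  | n'.+1 => fun x => diff X _ (@diffn k X n' i x)
  end.

Definition is_ncomplex (k : fieldType) (N : nat) (X : gcomplex k) : Prop :=
  forall (i : int) (x : X i), @diffn k X N i x = 0.

Record gmorphism (k : fieldType) (X Y : gcomplex k) := GMorphism {
  gmor :> forall i : int, {linear X i -> Y i};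
  gmor_diff : forall (i : int) (x : X i),
    gmor (i + 1) (diff X i x) = diff Y i (gmor i x)
}.

Definition ncomplex_iso (k : fieldType) (N : nat) (X Y : gcomplex k) : Prop :=
  [/\ is_ncomplex N X, is_ncomplex N Y &
      exists (f : gmorphism X Y) (g : gmorphism Y X),
        (forall i, cancel (f i) (g i)) /\ (forall i, cancel (g i) (f i))].

Definition gzero (k : fieldType) : gcomplex k :=
  @GComplex k (fun=> 'rV[k]_0) (fun=> idfun).

Section DirectSum.
Context (k : fieldType) (X Y : gcomplex k).

Definition gadd_gr (i : int) : lmodType k := (X i * Y i)%type.

Definition gadd_fun (i : int) (z : gadd_gr i) : gadd_gr (i + 1) :=
  (diff X i z.1, diff Y i z.2).

Fact gadd_fun_linear (i : int) : linear (@gadd_fun i).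
Proof. by move=> a z z'; rewrite /gadd_fun !linearP. Qed.

HB.instance Definition _ (i : int) :=
  GRing.isLinear.Build k (gadd_gr i) (gadd_gr (i + 1)) *:%R (@gadd_fun i)
    (@gadd_fun_linear i).

Definition gadd : gcomplex k := @GComplex k gadd_gr (fun i => @gadd_fun i).

End DirectSum.

(* Row vectors of length 1 are k and those of length 0 are zero, so that      *)
(* multiplication by an all-ones matrix is the identity k -> k inside the     *)
(* interval [i, i + l] and the zero map as soon as one end is 0.              *)
Definition indec_dim (i : int) (l : nat) (j : int) : nat :=
  (i <= j <= i + l%:Z)%R : bool.

Definition indec (k : fieldType) (i : int) (l : nat) : gcomplex k :=
  @GComplex k (fun j => 'rV[k]_(indec_dim i l j))
    (fun j => mulmxr (const_mx 1 : 'M[k]_(indec_dim i l j,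
                                          indec_dim i l (j + 1)))).

(* The degree i part of the tensor product, the direct sum of all             *)
(* X_j (x) Y_r with j + r = i, presented by generators (x, y), with x in some *)
(* X_j, y in some Y_r and j + r = i, and bilinearity relations. Its universal *)
(* property is [tens_lift_pure] and [tens_ext].                               *)
Section TensorSpace.
Context (k : fieldType) (X Y : gcomplex k) (i : int).

Definition tens_gen :=
  {p : {j : int & X j} * {r : int & Y r} | tag p.1 + tag p.2 == i}.

Definition tens_mk (j r : int) (h : j + r == i) (x : X j) (y : Y r) :
    tens_gen :=
  exist (fun p : {j : int & X j} * {r : int & Y r} => tag p.1 + tag p.2 == i)
    (existT _ j x, existT _ r y) h.

Definition tens_free := {freeg tens_gen / k}.

Definition tens_basis (j r : int) (h : j + r == i) (x : X j) (y : Y r) :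
    tens_free := << tens_mk h x y >>.

Inductive tens_rel : tens_free -> Prop :=
| TensRel0 : tens_rel 0
| TensRelP (a : k) (f g : tens_free) :
    tens_rel f -> tens_rel g -> tens_rel (a *: f + g)
| TensRelL (j r : int) (h : j + r == i) (a : k) (x x' : X j) (y : Y r) :
    tens_rel (tens_basis h (a *: x + x') y
              - (a *: tens_basis h x y + tens_basis h x' y))
| TensRelR (j r : int) (h : j + r == i) (a : k) (x : X j) (y y' : Y r) :
    tens_rel (tens_basis h x (a *: y + y')
              - (a *: tens_basis h x y + tens_basis h x y')).

Definition tens_relb : {pred tens_free} := fun f => `[< tens_rel f >].

Fact tens_relb_closed : zmod_closed tens_relb.
Proof.
split=> [|f g /asboolP hf /asboolP hg]; apply/asboolP; first exact: TensRel0.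
by rewrite addrC -scaleN1r; apply: TensRelP.
Qed.

HB.instance Definition _ :=
  GRing.isZmodClosed.Build tens_free tens_relb tens_relb_closed.

Definition tens := Quotient.quot tens_relb.

HB.instance Definition _ := Choice.on tens.
HB.instance Definition _ := GRing.Zmodule.on tens.

Definition tens_pi (f : tens_free) : tens := \pi f.

Lemma tens_piP (f g : tens_free) : tens_pi f = tens_pi g <-> tens_rel (f - g).
Proof.
rewrite /tens_pi; split=> [/eqP|h].
  by rewrite -Quotient.idealrBE => /asboolP.
by apply/eqP; rewrite -Quotient.idealrBE; apply/asboolP.
Qed.

Definition tens_scale (a : k) (t : tens) : tens := tens_pi (a *: repr t).

Fact tens_piD : {morph tens_pi : f g / f + g}.
Proof. by move=> f g; rewrite /tens_pi piE. Qed.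

Fact tens_reprK (t : tens) : tens_pi (repr t) = t.
Proof. exact: reprK. Qed.

Fact tens_piZ (a : k) (f : tens_free) :
  tens_pi (a *: f) = tens_scale a (tens_pi f).
Proof.
apply/tens_piP; rewrite -scalerBr -[_ *: _]addr0.
apply: TensRelP; last exact: TensRel0.
by apply/tens_piP; rewrite tens_reprK.
Qed.

Fact tens_scaleA (a b : k) (t : tens) :
  tens_scale a (tens_scale b t) = tens_scale (a * b) t.
Proof. by rewrite -[t]tens_reprK -!tens_piZ scalerA. Qed.

Fact tens_scale1 : left_id 1 tens_scale.
Proof. by move=> t; rewrite -[t]tens_reprK -!tens_piZ scale1r. Qed.

Fact tens_scaleDr : right_distributive tens_scale +%R.
Proof.
move=> a s t; rewrite -[s]tens_reprK -[t]tens_reprK -tens_piD -!tens_piZ.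
by rewrite scalerDr tens_piD.
Qed.

Fact tens_scaleDl (t : tens) : {morph tens_scale^~ t : a b / a + b}.
Proof.
by move=> a b; rewrite -[t]tens_reprK -!tens_piZ scalerDl tens_piD.
Qed.

HB.instance Definition _ :=
  GRing.Zmodule_isLmodule.Build k tens
    tens_scaleA tens_scale1 tens_scaleDr tens_scaleDl.

Fact tens_pi_linear : linear tens_pi.
Proof. by move=> a f g; rewrite tens_piD tens_piZ. Qed.

HB.instance Definition _ :=
  GRing.isLinear.Build k tens_free tens *:%R tens_pi tens_pi_linear.

Definition pure (j r : int) (h : j + r == i) (x : X j) (y : Y r) : tens :=
  tens_pi (tens_basis h x y).

Lemma pure_linearl (j r : int) (h : j + r == i) (y : Y r) :
  linear (fun x : X j => pure h x y).
Proof.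
by move=> a x x'; rewrite /pure -linearP; apply/tens_piP; apply: TensRelL.
Qed.

Lemma pure_linearr (j r : int) (h : j + r == i) (x : X j) :
  linear (fun y : Y r => pure h x y).
Proof.
by move=> a y y'; rewrite /pure -linearP; apply/tens_piP; apply: TensRelR.
Qed.

Section Lift.
Context (W : lmodType k).

Record bilin_family := BilinFamily {
  bilin :> forall j r : int, j + r == i -> X j -> Y r -> W;
  bilin_linearl : forall (j r : int) (h : j + r == i) (y : Y r),
    linear (fun x : X j => bilin h x y);
  bilin_linearr : forall (j r : int) (h : j + r == i) (x : X j),
    linear (fun y : Y r => bilin h x y)
}.

Variable b : bilin_family.

Definition tens_gen_lift (p : tens_gen) : W :=
  b _ _ (proj2_sig p) (tagged (sval p).1) (tagged (sval p).2).

Definition free_lift (f : tens_free) : W := fglift tens_gen_lift f.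

Fact free_lift_linear : linear free_lift.
Proof.
rewrite /free_lift.
have addP : additive (fglift tens_gen_lift) := lift_is_additive _.
have h0 : fglift tens_gen_lift 0 = 0.
  by have := addP 0 0; rewrite !subrr.
have hN f : fglift tens_gen_lift (- f) = - fglift tens_gen_lift f.
  by have := addP 0 f; rewrite !sub0r h0 sub0r.
have hD f g : fglift tens_gen_lift (f + g)
    = fglift tens_gen_lift f + fglift tens_gen_lift g.
  by have := addP f (- g); rewrite hN !opprK.
have hS (s : seq tens_gen) (F : tens_gen -> tens_free) :
    fglift tens_gen_lift (\sum_(z <- s) F z)
    = \sum_(z <- s) fglift tens_gen_lift (F z).
  by apply: (big_morph _ hD h0).
move=> a f g; rewrite hD; congr (_ + _).
rewrite -[f in RHS]freeg_sumE [LHS]hS hS scaler_sumr.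
by apply: eq_bigr => z _; rewrite !liftU scalerA.
Qed.

HB.instance Definition _ :=
  GRing.isLinear.Build k tens_free W *:%R free_lift
    free_lift_linear.

Fact free_lift_rel (f : tens_free) : tens_rel f -> free_lift f = 0.
Proof.
elim=> [|a g h _ hg _ hh|j r h a x x' y|j r h a x y y'].
- exact: linear0.
- by rewrite linearP /= hg hh scaler0 addr0.
- rewrite linearB linearP /= /free_lift /tens_basis !liftU !scale1r /tens_gen_lift /=.
  by apply/eqP; rewrite subr_eq0; apply/eqP; apply: bilin_linearl.
- rewrite linearB linearP /= /free_lift /tens_basis !liftU !scale1r /tens_gen_lift /=.
  by apply/eqP; rewrite subr_eq0; apply/eqP; apply: bilin_linearr.
Qed.

Definition tens_lift (t : tens) : W := free_lift (repr t).

Fact tens_lift_pi (f : tens_free) :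
  tens_lift (tens_pi f) = free_lift f.
Proof.
apply/eqP; rewrite -subr_eq0 -linearB; apply/eqP/free_lift_rel/tens_piP.
exact: tens_reprK.
Qed.

Fact tens_lift_linear : linear tens_lift.
Proof.
move=> a s t; rewrite -[s]tens_reprK -[t]tens_reprK -linearP.
by rewrite !tens_lift_pi linearP.
Qed.

HB.instance Definition _ :=
  GRing.isLinear.Build k tens W *:%R tens_lift tens_lift_linear.

Lemma tens_lift_pure (j r : int) (h : j + r == i) (x : X j) (y : Y r) :
  tens_lift (pure h x y) = b j r h x y.
Proof. by rewrite tens_lift_pi /free_lift /= liftU scale1r. Qed.

End Lift.

Lemma tens_ext (W : lmodType k) (f g : {linear tens -> W}) :
  (forall (j r : int) (h : j + r == i) (x : X j) (y : Y r),
     f (pure h x y) = g (pure h x y)) -> f =1 g.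
Proof.
move=> fg t; rewrite -[t]tens_reprK -[repr t]freeg_sumE !linear_sum.
apply: eq_bigr => z _.
have ->: << coeff z (repr t) *g z >> = coeff z (repr t) *: << z >> :> tens_free.
  by apply/eqP/freeg_eqP => w; rewrite coeffZ !coeffU mul1r.
rewrite !linearZ; congr (_ *: _).
by case: z => [[[j x] [r y]] h]; apply: fg.
Qed.

End TensorSpace.

Section Tensor.
Context (k : fieldType) (q : k) (X Y : gcomplex k).

Fact tens_degr (i j r : int) : j + r == i -> j + (r + 1) == i + 1.
Proof. by move/eqP<-; rewrite addrA. Qed.

Fact tens_degl (i j r : int) : j + r == i -> (j + 1) + r == i + 1.
Proof. by move/eqP<-; rewrite addrAC. Qed.

Definition tdiff_bilin (i j r : int) (h : j + r == i) (x : X j) (y : Y r) :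
    tens X Y (i + 1) :=
  pure (tens_degr h) x (diff Y r y) + q ^ r *: pure (tens_degl h) (diff X j x) y.

Fact tdiff_linearl (i j r : int) (h : j + r == i) (y : Y r) :
  linear (fun x : X j => tdiff_bilin h x y).
Proof.
move=> a x x'; rewrite /tdiff_bilin linearP !pure_linearl.
by rewrite !scalerDr !scalerA mulrC addrACA.
Qed.

Fact tdiff_linearr (i j r : int) (h : j + r == i) (x : X j) :
  linear (fun y : Y r => tdiff_bilin h x y).
Proof.
move=> a y y'; rewrite /tdiff_bilin linearP !pure_linearr.
by rewrite !scalerDr !scalerA mulrC addrACA.
Qed.

Definition tdiff (i : int) : tens X Y i -> tens X Y (i + 1) :=
  @tens_lift k X Y i (tens X Y (i + 1))
    (BilinFamily (@tdiff_linearl i) (@tdiff_linearr i)).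

HB.instance Definition _ (i : int) := GRing.Linear.on (@tdiff i).

Definition gtensor : gcomplex k :=
  @GComplex k (fun i => tens X Y i) (fun i => @tdiff i).

Lemma diff_pure (i j r : int) (h : j + r == i) (x : X j) (y : Y r) :
  diff gtensor i (pure h x y)
  = pure (tens_degr h) x (diff Y r y)
    + q ^ r *: pure (tens_degl h) (diff X j x) y.
Proof. exact: tens_lift_pure. Qed.

End Tensor.

(* Main.v *)
From HB Require Import structures.
Require Import Defs.
From mathcomp Require Import all_boot all_order all_algebra.
From mathcomp Require Import zify ring boolp.

Set Implicit Arguments.
Unset Strict Implicit.
Unset Printing Implicit Defensive.

Import GRing.Theory.
Local Open Scope ring_scope.

(* On the basis e_a (x) f_b (0 <= a <= u, 0 <= b <= v, degree i + j + a + b),  *)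
(* suitably rescaled, the differential E of the tensor product does not       *)
(* depend on i and j. As for the quantum group of sl_2 there is a lowering    *)
(* operator F with FE - EF = (1 - q) (q^m - q^(u+v-m)) in degree m. For       *)
(* l + N - 1 <= u + v the vector e_l (x) f_0 generates a string of length N:  *)
(* the entries of its images under E are q-binomial coefficients. For the     *)
(* other l <= min(u, v), a vector of degree l killed by F generates a string  *)
(* ending in degree u + v - l. All these strings end in distinct degrees, so  *)
(* they are linearly independent, and their total length is (u+1) (v+1), so   *)
(* they form a basis.                                                         *)

(** * Strings in the space of coordinate matrices *)

(** A direct summand M_p^n of a complex is a string x, E x, ..., E^n x with E^(n+1) x = 0, so the
    theorem asks for a basis of the tensor product made of strings. In coordinates ([coord],
    [realize], [diff_realize]) degree i + j + m of the tensor product is the antidiagonal a + b = m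
    of a matrix, E is [raise] and F is [lower]; write [n] for [br n].

    If x has degree l and F x = 0, then with n = u + v - 2l the sl_2 computation [lower_iter_raise]
    gives F E^s x = q^l [s] [n+1-s] E^(s-1) x. When n < N the coefficients for 1 <= s <= n are
    nonzero, so E^n x is nonzero; E^(n+1) x is killed by F in a degree where F is injective
    ([lower_inj]), so it is 0. This serves l > e, where e = u + v - (N-1). For l <= e the string of
    e_l (x) f_0 has q-binomial entries ([iter_raise_unit_arr]), which all vanish at the N-th step
    because [N] = 0.

    The strings with l <= e end in degree l + N - 1 >= N - 1, the others in u + v - l < N - 1.
    Distinct ends give independence ([str_free]), and the count [str_idx_card] gives spanning
    ([str_span]). The notion [strung] turns such a basis into an isomorphism with an iterated [gadd]
    ([strung_iso], [tensor_iso]). *)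

Section Arrays.
Context (k : fieldType) (q : k) (u v : nat).
(* A matrix c stands for the sum of the c a b times the rescaled e_a (x) f_b. *)
Notation arr := ('M[k]_(u.+1, v.+1)).

Definition entry (a b : nat) (c : arr) : k :=
  if (a <= u)%N && (b <= v)%N then c (inord a) (inord b) else 0.
Local Notation ent c a b := (entry a b c).

Definition arr_of (f : nat -> nat -> k) : arr := \matrix_(a, b) f a b.

Lemma ent_arr_of f a b :
  ent (arr_of f) a b = if (a <= u)%N && (b <= v)%N then f a b else 0.
Proof. by rewrite /entry; case: ifP => // /andP[au bv]; rewrite mxE !inordK. Qed.

Lemma ent_linear a b : linear (entry a b : arr -> k^o).
Proof.
move=> t c d; rewrite /entry; case: ifP => _; last by rewrite scaler0 addr0.
by rewrite !mxE.
Qed.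

HB.instance Definition _ a b :=
  GRing.isLinear.Build k arr k^o *:%R (entry a b) (ent_linear a b).

Lemma entP (c d : arr) :
  (forall a b, (a <= u)%N -> (b <= v)%N -> ent c a b = ent d a b) -> c = d.
Proof.
move=> cd; apply/matrixP => a b.
have := cd a b (leq_ord a) (leq_ord b).
by rewrite /entry !leq_ord !inord_val.
Qed.

Lemma ent_out (c : arr) a b : ~~ ((a <= u)%N && (b <= v)%N) -> ent c a b = 0.
Proof. by rewrite /entry => /negbTE->. Qed.

(** * The operators E and F and their commutation relation *)

Definition raise (c : arr) : arr := arr_of (fun a b =>
  (if b is b'.+1 then ent c a b' else 0)
  + q ^+ b * (if a is a'.+1 then ent c a' b else 0)).

(* The q-integer [n] times 1 - q; no denominators are then needed. *)
Definition br n : k := 1 - q ^+ n.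

Definition lower (c : arr) : arr := arr_of (fun a b =>
  q ^+ (u - a) * br b.+1 * br (v - b) * ent c a b.+1
  + br a.+1 * br (u - a) * ent c a.+1 b).

Lemma entD a b (c d : arr) : ent (c + d) a b = ent c a b + ent d a b.
Proof. exact: (linearD (entry a b : arr -> k^o)). Qed.

Lemma entZ a b t (c : arr) : ent (t *: c) a b = t * ent c a b.
Proof. exact: (linearZ_LR (entry a b : arr -> k^o)). Qed.

Lemma ent0 a b : ent 0 a b = 0.
Proof. exact: (linear0 (entry a b : arr -> k^o)). Qed.

Lemma ent_sum a b I (r : seq I) P (G : I -> arr) :
  ent (\sum_(i <- r | P i) G i) a b = \sum_(i <- r | P i) ent (G i) a b.
Proof. exact: (linear_sum (entry a b : arr -> k^o)). Qed.

Lemma raise_linear : linear raise.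
Proof.
move=> t c d; apply: entP => a b au bv.
rewrite entD entZ !ent_arr_of au bv /=.
by case: a au => [|a] _; case: b bv => [|b] _; rewrite ?entD ?entZ; ring.
Qed.
HB.instance Definition _ := GRing.isLinear.Build k arr arr *:%R raise raise_linear.

Lemma lower_linear : linear lower.
Proof.
move=> t c d; apply: entP => a b au bv.
by rewrite entD entZ !ent_arr_of au bv /= !entD !entZ; ring.
Qed.
HB.instance Definition _ := GRing.isLinear.Build k arr arr *:%R lower lower_linear.

Lemma iter_raise_linear n : linear (iter n raise).
Proof.
move=> t c d; elim: n => //= n ->; exact: raise_linear.
Qed.
HB.instance Definition _ n :=
  GRing.isLinear.Build k arr arr *:%R (iter n raise) (iter_raise_linear n).

Definition homog (m : nat) (c : arr) := forall a b, (a + b != m)%N -> ent c a b = 0.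

Lemma homog_raise m c : homog m c -> homog m.+1 (raise c).
Proof.
move=> hc a b ab; rewrite ent_arr_of; case: ifP => // _.
by case: a ab => [|a]; case: b => [|b] ab; rewrite ?hc ?mulr0 ?addr0 //; lia.
Qed.

Lemma homog_iter_raise n m c : homog m c -> homog (n + m) (iter n raise c).
Proof. by move=> hc; elim: n => //= n IH; apply: homog_raise. Qed.

(** Away from the border this is a polynomial identity in powers of q. At the border the factors
    [v - b] and [u - a] of F vanish exactly where E c would need an entry outside the matrix. *)
Lemma raise_lower m c : homog m c ->
  lower (raise c) = raise (lower c) + ((1 - q) * (q ^+ m - q ^+ (u + v - m))) *: c.
Proof.
move=> hc; apply: entP => a b au bv; rewrite entD entZ.
(* Only entries with a + b = m matter, and for them the truncated u + v - m splits as (u - a) + (v -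
   b). *)
have -> : (1 - q) * (q ^+ m - q ^+ (u + v - m)) * ent c a b
    = (1 - q) * (q ^+ (a + b) - q ^+ (u - a) * q ^+ (v - b)) * ent c a b.
  have [<-|/hc->] := eqVneq (a + b)%N m; last by rewrite !mulr0.
  by rewrite -exprD; congr (_ * (_ - q ^+ _) * _); lia.
rewrite [in RHS]ent_arr_of [in LHS]ent_arr_of au bv /=.
have Hb : br (v - b) * ent (raise c) a b.+1
    = br (v - b) * (ent c a b + q ^+ b.+1 * (if a is a'.+1 then ent c a' b.+1 else 0)).
  rewrite ent_arr_of au /=; case: ltnP => // vb.
  by rewrite (_ : v - b = 0)%N ?/br ?subrr ?mul0r //; lia.
have Ha : br (u - a) * ent (raise c) a.+1 b
    = br (u - a) * ((if b is b'.+1 then ent c a.+1 b' else 0) + q ^+ b * ent c a b).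
  rewrite ent_arr_of bv /= andbT; case: ltnP => // ua.
  by rewrite (_ : u - a = 0)%N ?/br ?subrr ?mul0r //; lia.
rewrite -!mulrA Hb Ha.
case: a au {Hb Ha} => [|a] au; case: b bv => [|b] bv;
  rewrite ?ent_arr_of /= ?(ltnW au) ?(ltnW bv) ?au ?bv /= ?leq0n /= ?subn0.
- rewrite /br; ring.
- rewrite /br (_ : v - b = (v - b.+1).+1)%N; last lia.
  rewrite !exprS; ring.
- rewrite /br (_ : u - a = (u - a.+1).+1)%N; last lia.
  rewrite [(a.+1 + 0)%N]addn0 !exprS; ring.
- rewrite /br (_ : u - a = (u - a.+1).+1)%N; last lia.
  rewrite (_ : v - b = (v - b.+1).+1)%N; last lia.
  rewrite !exprD !exprS; ring.
Qed.

(** Moving F past each E in turn adds the commutator scalars of degrees m, ..., m + s - 1; their sum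
    factors as stated. *)
Lemma lower_iter_raise m n s c : homog m c -> lower c = 0 ->
    (n + m.*2 = u + v)%N -> (s <= n.+1)%N ->
  lower (iter s raise c) = (q ^+ m * br s * br (n.+1 - s)) *: iter s.-1 raise c.
Proof.
move=> hc c0 nm; elim: s => [|s IH] sn.
  by rewrite /= c0 /br subrr mulr0 mul0r scale0r.
rewrite iterS (raise_lower (homog_iter_raise hc)) IH; last lia.
(* For s = 0 the exponent [s.-1] is truncated, but there the coefficient [0] is zero. *)
case: s sn {IH} => [|s] sn /=.
  rewrite /br !subrr !(mulr0, mul0r) scale0r linear0 add0r expr1.
  rewrite (_ : u + v - (0 + m) = m + n)%N; last lia.
  by rewrite (_ : n.+1 - 1 = n)%N ?exprD; [congr (_ *: _); ring|lia].
rewrite linearZ /= -scalerDl; congr (_ *: _).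
rewrite (_ : u + v - (s.+1 + m) = m + (n.+1 - s.+2))%N; last lia.
rewrite (_ : n.+1 - s.+1 = (n.+1 - s.+2).+1)%N; last lia.
rewrite /br !exprD !exprS; ring.
Qed.

(** * Generators of the strings, and projections to one degree *)

Fixpoint prim_coef l b : k :=
  if b is b'.+1 then
    - prim_coef l b' * (br (l - b') * br (u - (l - b).+1).+1)
      / (q ^+ (u - (l - b)) * br b * br (v - b'))
  else 1.

(** The coefficients solve F c = 0 along the antidiagonal: with a = l - b, entry (a, b-1) of F c
    gives q^(u-a) [b] [v-b+1] c_b + [a+1] [u-a] c_(b-1) = 0. In [prim_coef] the factor u - a is
    written [(u - (l - b).+1).+1], which is the same for a < u. *)
Definition prim_arr l := arr_of (fun a b => if (a + b == l)%N then prim_coef l b else 0).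

Lemma homog_prim_arr l : homog l (prim_arr l).
Proof. by move=> a b ab; rewrite ent_arr_of (negbTE ab) if_same. Qed.

Lemma prim_arr_neq0 l : (l <= u)%N -> prim_arr l != 0.
Proof.
move=> lu; apply/eqP => /(congr1 (fun c => ent c l 0)) /eqP.
by rewrite ent0 ent_arr_of lu leq0n addn0 eqxx oner_eq0.
Qed.

Definition unit_arr l := arr_of (fun a b => ((a == l) && (b == 0%N))%:R).

Lemma homog_unit_arr l : homog l (unit_arr l).
Proof.
move=> a b ab; rewrite ent_arr_of; case: ifP => // _.
by case: eqP => //= al; case: eqP => //= b0; lia.
Qed.

Definition brfact n : k := \prod_(1 <= m < n.+1) br m.

Lemma brfactS n : brfact n.+1 = brfact n * br n.+1.
Proof. by rewrite /brfact big_nat_recr. Qed.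

Lemma br_add a b : br (a + b) = br b + q ^+ b * br a.
Proof. by rewrite /br exprD; ring. Qed.

(* The entries are Gaussian binomials; clearing the denominators makes         *)
(* Pascal's rule an instance of [br_add].                                     *)
Lemma iter_raise_unit_arr n l a b : (a <= u)%N -> (b <= v)%N ->
  brfact (a - l) * brfact b * ent (iter n raise (unit_arr l)) a b
  = if (a + b == n + l)%N && (l <= a)%N then brfact n else 0.
Proof.
move=> au bv; elim: n a b au bv => [|n IH] a b au bv.
  rewrite /= ent_arr_of au bv /= add0n.
  have [->|al] := eqVneq a l; last first.
    by rewrite mulr0; case: ifP => //; lia.
  have [->|b0] := eqVneq b 0%N.
    by rewrite subnn addn0 eqxx leqnn !mulr1 /brfact big_geq // mulr1.
  by rewrite mulr0; case: ifP => //; lia.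
rewrite iterS ent_arr_of au bv /=.
have IHb : brfact (a - l) * brfact b
     * (if b is b'.+1 then ent (iter n raise (unit_arr l)) a b' else 0)
    = br b * (if (a + b == n.+1 + l)%N && (l <= a)%N then brfact n else 0).
  case: b bv => [|b] bv; first by rewrite mulr0 /br subrr mul0r.
  have := IH a b au (ltnW bv); rewrite brfactS addSn addnS eqSS => <-; ring.
have IHa : brfact (a - l) * brfact b
     * (if a is a'.+1 then ent (iter n raise (unit_arr l)) a' b else 0)
    = br (a - l) * (if (a + b == n.+1 + l)%N && (l <= a)%N then brfact n else 0).
  case: a au {IHb} => [|a] au; first by rewrite mulr0 /br subrr mul0r.
  have := IH a b (ltnW au) bv.
  case: (ltngtP l a.+1) => [la|la|la].
  - rewrite subSn // brfactS addSn addSn eqSS -ltnS la !andbT => <-; ring.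
  - rewrite (_ : a.+1 - l = 0)%N; last lia.
    rewrite {1}(_ : 0 = a - l)%N; last lia.
    by move=> ->; rewrite (_ : (l <= a) = false)%N ?andbF ?mulr0 //; lia.
  - rewrite (_ : a.+1 - l = 0)%N; last lia.
    rewrite {1}(_ : 0 = a - l)%N; last lia.
    move=> ->; rewrite (_ : (l <= a) = false)%N; last lia.
    by rewrite andbF /br subrr mul0r.
rewrite mulrDr IHb mulrCA IHa mulrA -mulrDl -br_add.
case: ifP => [/andP[/eqP abn la]|_]; last by rewrite mulr0.
by rewrite brfactS mulrC; congr (_ * br _); lia.
Qed.

Definition proj (m : nat) (c : arr) :=
  arr_of (fun a b => if (a + b == m)%N then ent c a b else 0).

Lemma proj_linear m : linear (proj m).
Proof.
move=> t c d; apply: entP => a b au bv; rewrite entD entZ !ent_arr_of au bv /=.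
by case: ifP => _; rewrite ?entD ?entZ // mulr0 addr0.
Qed.
HB.instance Definition _ m :=
  GRing.isLinear.Build k arr arr *:%R (proj m) (proj_linear m).

Lemma homog_proj m c : homog m (proj m c).
Proof. by move=> a b ab; rewrite ent_arr_of (negbTE ab) if_same. Qed.

Lemma proj_homog m n c : homog n c -> proj m c = if n == m then c else 0.
Proof.
move=> hc; apply: entP => a b au bv; rewrite ent_arr_of au bv /=.
case: (eqVneq n m) => [<-|nm]; case: eqVneq => [abm|abm] //; rewrite ?ent0 ?hc //.
by rewrite abm eq_sym.
Qed.

(** * Strings at a primitive root of unity *)

Section RootOfUnity.
Context (N : nat).
Context (hq : N.-primitive_root q) (hu : (u < N)%N) (hv : (v < N)%N).

Lemma q_neq0 : q != 0.
Proof.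
apply/eqP => q0; have := prim_expr_order hq.
by rewrite q0 expr0n gtn_eqF ?(prim_order_gt0 hq) // => /esym/eqP; rewrite oner_eq0.
Qed.

Lemma br_neq0 n : (0 < n < N)%N -> br n != 0.
Proof.
case/andP=> n0 nN; rewrite /br subr_eq0 eq_sym -(prim_order_dvd hq).
by rewrite gtnNdvd.
Qed.

Lemma br_order : br N = 0.
Proof. by rewrite /br (prim_expr_order hq) subrr. Qed.

(** Column 0 of c vanishes because its only possible entry has row m > u. Then F c = 0 determines
    column b + 1 from column b, with a nonzero coefficient since b + 1 <= v < N. *)
Lemma lower_inj m c : (u < m)%N -> homog m c -> lower c = 0 -> c = 0.
Proof.
move=> um hc c0.
suff H b : forall a, (a <= u)%N -> (b <= v)%N -> ent c a b = 0.
  by apply: entP => a b au bv; rewrite ent0 H.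
elim: b => [|b IH] a au bv; first by apply: hc; lia.
have := congr1 (fun c => ent c a b) c0.
rewrite ent0 ent_arr_of au (ltnW bv) /=.
have -> : ent c a.+1 b = 0.
  by case: (leqP a.+1 u) => [/IH->//|ua]; [lia|rewrite ent_out//; lia].
rewrite mulr0 addr0 => /eqP; rewrite !mulf_eq0 expf_eq0 (negbTE q_neq0) andbF.
rewrite (negbTE (br_neq0 _)); last lia.
by rewrite (negbTE (br_neq0 _)) /=; [move/eqP | lia].
Qed.

Lemma lower_prim_arr l : (l <= u)%N -> (l <= v)%N -> lower (prim_arr l) = 0.
Proof.
move=> lu lv; apply: entP => a b au bv; rewrite ent0 ent_arr_of au bv /=.
have [abl|nl] := eqVneq (a + b).+1 l; last first.
  by rewrite !homog_prim_arr ?mulr0 ?addr0 //; lia.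
have lb : (l - b = a.+1)%N by lia.
have lb1 : (l - b.+1 = a)%N by lia.
have ua : ((u - a.+1).+1 = u - a)%N by lia.
have [au1 bv1] : (a < u)%N /\ (b < v)%N by lia.
rewrite !ent_arr_of addnS addSn abl eqxx au bv au1 bv1 /= lb lb1 ua.
field.
rewrite expf_neq0 ?q_neq0 //= !br_neq0 //; lia.
Qed.

(** F sends E^(s+1) x to a nonzero multiple of E^s x: the bound makes n < N, so [s+1] and [n-s] do
    not vanish. *)
Lemma raise_prim_arr_neq0 l : (l <= u)%N -> (l <= v)%N -> (u + v < N + l.*2)%N ->
  iter (u + v - l.*2) raise (prim_arr l) != 0.
Proof.
move=> lu lv wN; set n := (u + v - l.*2)%N.
suff H s : (s <= n)%N -> iter s raise (prim_arr l) != 0 by exact: H.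
elim: s => [|s IH] sn; first exact: prim_arr_neq0.
apply/eqP => /(congr1 lower).
rewrite (@lower_iter_raise l n) ?linear0; last first.
- exact: ltnW.
- by rewrite /n; lia.
- exact: lower_prim_arr.
- exact: homog_prim_arr.
move/eqP; apply/negP; rewrite scaler_eq0 negb_or IH ?(ltnW sn) // andbT.
by rewrite !mulf_neq0 ?expf_neq0 ?q_neq0 ?br_neq0 //; lia.
Qed.

(** The vector is killed by F because [n+1-s] = 0 at s = n + 1, and its degree u + v - l + 1 exceeds
    u, where F is injective. *)
Lemma raise_prim_arr_eq0 l : (l <= u)%N -> (l <= v)%N ->
  iter (u + v - l.*2).+1 raise (prim_arr l) = 0.
Proof.
move=> lu lv; set n := (u + v - l.*2)%N.
apply: (@lower_inj (n.+1 + l)); first by rewrite /n; lia.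
  exact/homog_iter_raise/homog_prim_arr.
rewrite (@lower_iter_raise l n) ?subnn //; last first.
- by rewrite /n; lia.
- exact: lower_prim_arr.
- exact: homog_prim_arr.
by rewrite /br subrr mulr0 scale0r.
Qed.

Lemma brfact_neq0 n : (n < N)%N -> brfact n != 0.
Proof.
elim: n => [|n IH] nN; first by rewrite /brfact big_geq // oner_eq0.
by rewrite brfactS mulf_neq0 ?IH ?br_neq0 //; lia.
Qed.

Lemma raise_unit_arr_neq0 l : (l + N.-1 <= u + v)%N ->
  iter N.-1 raise (unit_arr l) != 0.
Proof.
move=> lN; apply/eqP => H.
(* The entry in the last column b = v is the witness; its row lies between l and u because v <= N -
   1 and by [lN]. *)
have := @iter_raise_unit_arr N.-1 l (l + N.-1 - v) v _ (leqnn v).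
have -> : (l + N.-1 - v <= u)%N by lia.
rewrite H ent0 mulr0 (_ : _ && _ = true); last lia.
by move=> /(_ isT)/esym/eqP; rewrite (negbTE (brfact_neq0 _)) //; lia.
Qed.

(** [N]! contains [N] = 0, while the denominators [a-l]! and [b]! are nonzero since a, b < N. *)
Lemma raise_unit_arr_eq0 l : (l + N.-1 <= u + v)%N ->
  iter N.-1.+1 raise (unit_arr l) = 0.
Proof.
move=> lN; apply: entP => a b au bv; rewrite ent0.
have := @iter_raise_unit_arr N.-1.+1 l a b au bv.
rewrite brfactS prednK ?(prim_order_gt0 hq) // br_order mulr0 if_same.
move/eqP; rewrite !mulf_eq0 (negbTE (brfact_neq0 _)) ?(negbTE (brfact_neq0 _)) /=.
- by move/eqP.
- lia.
- lia.
Qed.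

(** * The strings form a basis *)

Definition str_len l := if (l + N.-1 <= u + v)%N then N.-1 else (u + v - l.*2)%N.

Definition str_gen l := if (l + N.-1 <= u + v)%N then unit_arr l else prim_arr l.

Lemma homog_str_gen l : homog l (str_gen l).
Proof.
rewrite /str_gen; case: ifP => _; first exact: homog_unit_arr.
exact: homog_prim_arr.
Qed.

Lemma str_gen_neq0 l : (l <= minn u v)%N -> iter (str_len l) raise (str_gen l) != 0.
Proof.
rewrite leq_min => /andP[lu lv]; rewrite /str_len /str_gen.
case: leqP => lN; first exact: raise_unit_arr_neq0.
by apply: raise_prim_arr_neq0 => //; lia.
Qed.

Lemma str_gen_eq0 l n : (l <= minn u v)%N -> (str_len l < n)%N ->
  iter n raise (str_gen l) = 0.
Proof.
move=> + /subnK <-; rewrite leq_min iterD => /andP[lu lv].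
rewrite [X in iter _ _ X](_ : _ = 0) ?linear0 // /str_len /str_gen.
case: leqP => lN; first exact: raise_unit_arr_eq0.
exact: raise_prim_arr_eq0.
Qed.

Definition act m l := (l <= m <= l + str_len l)%N.

(* The strings end in pairwise distinct degrees, so pushing a relation far    *)
(* enough up leaves the socle of a single string.                             *)
Lemma str_free m (al : nat -> k) :
  \sum_(l < (minn u v).+1 | act m l) al l *: iter (m - l) raise (str_gen l) = 0 ->
  forall l : 'I_(minn u v).+1, act m l -> al l = 0.
Proof.
move=> al0 l1 ml1; apply/eqP/negPn/negP => al1.
pose P (l : 'I_(minn u v).+1) := act m l && (al l != 0).
have Pl1 : P l1 by rewrite /P ml1.
case: (arg_maxnP (fun l : 'I_(minn u v).+1 => (l + str_len l)%N) Pl1)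
  => l /andP[ml all] lmax.
pose t := (l + str_len l - m)%N.
have := congr1 (iter t raise) al0.
rewrite linear0 linear_sum (bigD1 l) //= big1 => [|l' /andP[ml' ll']].
  rewrite addr0 linearZ /= -iterD => /eqP; rewrite scaler_eq0 (negbTE all) /=.
  have ->: (t + (m - l) = str_len l)%N by move: ml; rewrite /act /t; lia.
  by rewrite (negbTE (str_gen_neq0 (leq_ord l))).
rewrite linearZ /= -iterD.
have [->|all'] := eqVneq (al l') 0; first by rewrite scale0r.
rewrite str_gen_eq0 ?scaler0 ?leq_ord //.
have /lmax : P l' by rewrite /P ml'.
have : (l' : nat) <> l by move=> /val_inj e; rewrite e eqxx in ll'.
(* The ends are l + N - 1 >= N - 1 for full strings and u + v - l < N - 1 for the others, so l' and
   l end in different degrees. *)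
have := leq_ord l; have := leq_ord l'; move: ml ml'.
rewrite /act /t /str_len; case: (leqP (l + _)); case: (leqP (l' + _)) => /=; lia.
Qed.

Notation str_idx := {l : 'I_(minn u v).+1 & 'I_(str_len l).+1}.

Definition str_vec (p : str_idx) := iter (tagged p) raise (str_gen (tag p)).

(** A string has at most one vector in degree m, at position m - l. Indexing by [nat] matches the
    form of [str_free]; the value 0 outside the range is a filler. *)
Definition str_coef (al : str_idx -> k) (m n : nat) : k :=
  if (insub n : option 'I_(minn u v).+1) is Some l then
    al (existT _ l (inord (m - l)))
  else 0.

Lemma proj_str_sum m (al : str_idx -> k) :
  proj m (\sum_p al p *: str_vec p)
  = \sum_(l < (minn u v).+1 | act m l)
      str_coef al m l *: iter (m - l) raise (str_gen l).
Proof.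
pose F (l : 'I_(minn u v).+1) (s : 'I_(str_len l).+1) :=
  proj m (al (existT _ l s) *: iter s raise (str_gen l)).
have FE l s : F l s = al (existT _ l s)
    *: (if (s + l)%N == m then iter s raise (str_gen l) else 0).
  by rewrite /F linearZ /= (proj_homog _ (homog_iter_raise (@homog_str_gen l))).
rewrite linear_sum (eq_bigr (fun p : str_idx => F (tag p) (tagged p))); last by case.
rewrite -(sig_big_dep (fun _ => true) (fun _ _ => true) F) [RHS]big_mkcond /=.
apply: eq_bigr => l _; rewrite /str_coef valK; case: ifP => ml.
  rewrite (bigD1 (inord (m - l))) //= big1 ?addr0 => [|s sm]; rewrite FE.
    by rewrite inordK ?subnK ?eqxx //; move: ml; rewrite /act; lia.
  case: eqP => [e|]; last by rewrite scaler0.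
  by case/eqP: sm; apply: val_inj; rewrite /= inordK; move: ml; rewrite /act; lia.
apply: big1 => s _; rewrite FE.
by case: eqP => [e|]; [have := leq_ord s; move: ml; rewrite /act; lia|rewrite scaler0].
Qed.

(** The first M strings have total length M N as long as all are full, and M (u+v+2-M) afterwards;
    the two agree at M = e + 1. At M = min(u,v) + 1 the second is (u+1)(v+1). *)
Lemma str_idx_card : #|{: str_idx}| = (u.+1 * v.+1)%N.
Proof.
rewrite card_tagged sumnE big_map big_enum /=.
under eq_bigr do rewrite card_ord.
have H M : (M <= (minn u v).+1)%N ->
    (\sum_(l < M) (str_len l).+1 =
     if (M + N.-1 <= (u + v).+1)%N then M * N else M * (u + v + 2 - M))%N.
  elim: M => [|M IH] Mm; first by rewrite big_ord0 !mul0n if_same.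
  rewrite big_ord_recr /= IH ?(ltnW Mm) // /str_len.
  have M1: (M <= u)%N by lia.
  have M2: (M <= v)%N by lia.
  (* Writing u + v = 2M + r removes the truncated subtractions. *)
  have [r wr] : exists r, (u + v = M + M + r)%N by exists (u + v - M - M)%N; lia.
  rewrite !wr; do 3 case: ifP => ?; nia.
rewrite (eq_bigl xpredT) // H // addSn; case: ifP => ?; last by nia.
(* If all strings are full, then min(u,v) + N <= u + v + 1, which forces max(u,v) = N - 1. *)
have -> : N = (maxn u v).+1 by lia.
by rewrite /minn /maxn; case: ifP => _; lia.
Qed.

(** All string vectors, flattened to rows, are independent (degree by degree) and as many as the
    dimension, so they span; projecting a combination to degree m keeps the active strings only. *)
Lemma str_span m c : homog m c -> exists al : nat -> k,
  c = \sum_(l < (minn u v).+1 | act m l) al l *: iter (m - l) raise (str_gen l).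
Proof.
move=> hc.
pose A := \matrix_(i < #|{: str_idx}|) mxvec (str_vec (enum_val i)).
have mulA (d : 'rV_#|{: str_idx}|) :
    d *m A = mxvec (\sum_(p : str_idx) d 0 (enum_rank p) *: str_vec p).
  rewrite mulmx_sum_row linear_sum [RHS]big_enum_val /=.
  by apply: eq_bigr => i _; rewrite rowK enum_valK linearZ.
have Afree : row_free A.
  apply: inj_row_free => d; rewrite mulA -(linear0 mxvec) => /(can_inj mxvecK) d0.
  apply/rowP => i; rewrite mxE.
  case Ep: (enum_val i) => [l s].
  have := congr1 (proj (l + s)) d0; rewrite linear0 proj_str_sum.
  move/str_free/(_ l); rewrite /str_coef valK addKn inord_val.
  rewrite -Ep enum_valK; apply.
  by rewrite /act leq_addr leq_add2l leq_ord.
have : (mxvec c <= A)%MS.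
  apply: submx_full; move: Afree; rewrite /row_free /row_full => /eqP->.
  by rewrite str_idx_card.
case/submxP => d; rewrite mulA => /(can_inj mxvecK) cd.
have := proj_homog m hc; rewrite eqxx => <-; rewrite cd proj_str_sum.
by eexists.
Qed.

End RootOfUnity.
End Arrays.

(** * Direct sums of indecomposable complexes *)

Section Morphisms.
Context (k : fieldType) (X Y : gcomplex k) (f : gmorphism Y X).

Lemma gmor_diffn n i (y : Y i) : f _ (@diffn k Y n i y) = @diffn k X n i (f i y).
Proof. by elim: n => //= n <-; apply: gmor_diff. Qed.

Context (finj : forall i, injective (f i)).
Context (fsurj : forall i x, exists y, f i y = x).

Definition gmor_inv i (x : X i) : Y i := sval (cid (fsurj x)).

Lemma gmor_invK i : cancel (@gmor_inv i) (f i).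
Proof. by move=> x; rewrite /gmor_inv; case: cid. Qed.

Fact gmor_inv_linear i : linear (@gmor_inv i).
Proof. by move=> a x x'; apply: (finj (i := i)); rewrite linearP !gmor_invK. Qed.

HB.instance Definition _ i :=
  GRing.isLinear.Build k (X i) (Y i) *:%R (@gmor_inv i) (@gmor_inv_linear i).

Fact gmor_inv_diff i (x : X i) :
  gmor_inv (diff X i x) = diff Y i (gmor_inv x).
Proof. by apply: (finj (i := i + 1)); rewrite gmor_diff !gmor_invK. Qed.

(** Taking f from Y to X lets X inherit the N-complex condition from Y; for the tensor product it is
    obtained in this way, from the direct sum. *)
Lemma bij_ncomplex_iso N : is_ncomplex N Y -> ncomplex_iso N X Y.
Proof.
move=> NY; split=> //.
  by move=> i x; rewrite -(gmor_invK x) -gmor_diffn NY linear0.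
exists (@GMorphism k X Y (fun i => @gmor_inv i) gmor_inv_diff), f.
by split=> i x /=; [exact: gmor_invK | apply: (finj (i := i)); rewrite gmor_invK].
Qed.

End Morphisms.

Section NComplexes.
Context (k : fieldType) (N : nat).

Lemma diffn0 (X : gcomplex k) n i : @diffn k X n i 0 = 0.
Proof. by elim: n => //= n ->; rewrite linear0. Qed.

Lemma gzero_ncomplex : is_ncomplex N (gzero k).
Proof. by move=> i x; apply: thinmx0. Qed.

Lemma gadd_ncomplex (X Y : gcomplex k) :
  is_ncomplex N X -> is_ncomplex N Y -> is_ncomplex N (gadd X Y).
Proof.
move=> NX NY i z.
suff -> : @diffn k (gadd X Y) N i z = (@diffn k X N i z.1, @diffn k Y N i z.2).
  by rewrite NX NY.
by elim: N => [|n /= ->]; first by case: z.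
Qed.

Lemma indec_out i l j (x : indec k i l j) : ~~ (i <= j <= i + l%:Z) -> x = 0.
Proof.
move=> h; move: x; rewrite /= /indec_dim (negbTE h) => x; exact: thinmx0.
Qed.

Lemma indec_ncomplex i l : (l < N)%N -> is_ncomplex N (indec k i l).
Proof.
move=> lN j x; have [h|h] := boolP (i <= j <= i + l%:Z); last first.
  by rewrite (indec_out x h) diffn0.
(* An interval of l + 1 <= N degrees cannot contain both j and j + N. *)
apply: indec_out.
have -> : iter N (fun j => j + 1) j = j + N%:Z.
  by elim: {lN} N => [|n /= ->] /=; lia.
lia.
Qed.

End NComplexes.

Section RowSum.
Context (k : fieldType).

(** On rows of length 0 or 1 this is the coordinate, uniformly in the length; it avoids casts on
    [indec_dim]. *)
Definition row_sum n (x : 'rV[k]_n) : k := \sum_j x 0 j.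

Lemma row_sumP n a (x y : 'rV[k]_n) :
  row_sum (a *: x + y) = a * row_sum x + row_sum y.
Proof.
rewrite /row_sum mulr_sumr -big_split.
by apply: eq_bigr => j _; rewrite !mxE.
Qed.

Lemma row_sum0 n : row_sum (0 : 'rV[k]_n) = 0.
Proof. by rewrite /row_sum big1 // => j _; rewrite mxE. Qed.

Lemma row_sum_const n a : row_sum (const_mx a : 'rV[k]_n) = n%:R * a.
Proof.
rewrite /row_sum (eq_bigr (fun=> a)) => [|j _]; last by rewrite mxE.
by rewrite sumr_const card_ord mulr_natl.
Qed.

Lemma row_sum_mulmx m n (x : 'rV[k]_m) :
  row_sum (x *m const_mx 1 : 'rV_n) = n%:R * row_sum x.
Proof.
rewrite {1}/row_sum (eq_bigr (fun=> row_sum x)) => [|j _].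
  by rewrite sumr_const card_ord mulr_natl.
by rewrite mxE; apply: eq_bigr => a _; rewrite mxE mulr1.
Qed.

Lemma row_sumK (b : bool) (x : 'rV[k]_b) : x = const_mx (row_sum x).
Proof.
case: b x => x; apply/rowP; last by case.
by move=> j; rewrite /row_sum big_ord1 ord1 mxE.
Qed.

End RowSum.

(** * From strings in a complex to maps out of direct sums *)

Section Strings.
Context (k : fieldType) (X : gcomplex k).
Context (p : nat -> int) (len : nat -> nat) (y : nat -> forall m, X m).
Notation on l m := (p l <= m <= p l + (len l)%:Z).

Definition is_string l := forall m, on l m ->
  diff X m (y l m) = if on l (m + 1) then y l (m + 1) else 0.

(** Y behaves as the complex freely spanned by the strings of r, and f evaluates coefficients in X.
    Independence of the y l m in X is not part of it, so it passes through direct sums by induction,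
    and no coordinates on an iterated [gadd] are needed. *)
Definition strung (Y : gcomplex k) (r : seq nat) : Prop :=
  exists f : gmorphism Y X, forall m,
    (forall z : Y m, exists al : nat -> k,
       f m z = \sum_(l <- r | on l m) al l *: y l m /\
       ((forall l, l \in r -> on l m -> al l = 0) -> z = 0))
    /\ (forall al : nat -> k, exists z : Y m,
       f m z = \sum_(l <- r | on l m) al l *: y l m).

Definition string_map l m (z : indec k (p l) (len l) m) : X m :=
  row_sum z *: y l m.

Fact string_map_linear l m : linear (@string_map l m).
Proof.
by move=> a z z'; rewrite /string_map row_sumP scalerDl scalerA.
Qed.
HB.instance Definition _ l m := GRing.isLinear.Build k
  (indec k (p l) (len l) m) (X m) *:%R (@string_map l m) (@string_map_linear l m).

Fact string_map_diff l (yl : is_string l) m (z : indec k (p l) (len l) m) :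
  string_map (diff (indec k (p l) (len l)) m z) = diff X m (string_map z).
Proof.
rewrite /string_map linearZ /= row_sum_mulmx {1}/indec_dim.
have [h|h] := boolP (on l m); last first.
  by rewrite (indec_out z h) row_sum0 mulr0 !scale0r.
by rewrite yl //; case: ifP => _; rewrite ?mul1r // mul0r scale0r scaler0.
Qed.

Lemma strung_indec l : is_string l -> strung (indec k (p l) (len l)) [:: l].
Proof.
move=> yl; exists (GMorphism (string_map_diff yl)) => m; split=> [z|al].
  exists (fun=> row_sum z); split.
    rewrite big_mkcond big_seq1 /=; case: ifPn => // h.
    by rewrite (indec_out z h) linear0.
  have [h|h _] := boolP (on l m); last exact: indec_out.
  move=> /(_ l (mem_head _ _) h) z0.
  by rewrite /= [z]row_sumK z0; apply/rowP => j; rewrite !mxE.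
exists (const_mx (al l)); rewrite big_mkcond big_seq1 /= /string_map.
rewrite row_sum_const /indec_dim.
by case: ifP => _; rewrite ?mul1r // mul0r scale0r.
Qed.

Lemma strung_gzero : strung (gzero k) [::].
Proof.
have zd m (z : gzero k m) :
    (\0 : {linear gzero k (m + 1) -> X (m + 1)}) (diff (gzero k) m z)
   = diff X m ((\0 : {linear gzero k m -> X m}) z).
  by rewrite /= linear0.
exists (@GMorphism k (gzero k) X (fun m => \0) zd) => m; split=> [z|al].
  by exists (fun=> 0); rewrite big_nil; split=> // _; apply: thinmx0.
by exists 0; rewrite big_nil.
Qed.

Section Add.
Context (Y Z : gcomplex k) (f : gmorphism Y X) (g : gmorphism Z X).

Definition copair m (z : gadd Y Z m) : X m := f m z.1 + g m z.2.

Fact copair_linear m : linear (@copair m).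
Proof.
by move=> a z z'; rewrite /copair !linearP scalerDr addrACA.
Qed.
HB.instance Definition _ m := GRing.isLinear.Build k
  (gadd Y Z m) (X m) *:%R (@copair m) (@copair_linear m).

Fact copair_diff m (z : gadd Y Z m) :
  copair (diff (gadd Y Z) m z) = diff X m (copair z).
Proof. by rewrite /copair linearD -!gmor_diff. Qed.

End Add.

(** Disjointness of r and s allows the two coefficient functions to be glued into one. *)
Lemma strung_gadd Y Z r s : uniq (r ++ s) ->
  strung Y r -> strung Z s -> strung (gadd Y Z) (r ++ s).
Proof.
rewrite cat_uniq => /and3P[_ /hasPn rs _] [f fP] [g gP].
have sr l : l \in s -> l \in r = false by move=> /rs/negbTE.
exists (GMorphism (copair_diff f g)) => m.
have [f1 f2] := fP m; have [g1 g2] := gP m; split=> [[z1 z2]|al].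
  have [al1 [e1 i1]] := f1 z1; have [al2 [e2 i2]] := g1 z2.
  exists (fun l => if l \in r then al1 l else al2 l); split.
    rewrite big_cat /= /copair e1 e2; congr (_ + _).
      by rewrite [LHS]big_seq_cond [RHS]big_seq_cond; apply: eq_bigr => l /andP[-> _].
    by rewrite [LHS]big_seq_cond [RHS]big_seq_cond; apply: eq_bigr => l /andP[/sr-> _].
  move=> al0; rewrite i1 ?i2 // => l lr hl.
    by have := al0 l; rewrite mem_cat lr orbT (sr l lr) => ->.
  by have := al0 l; rewrite mem_cat lr => ->.
have [z1 e1] := f2 al; have [z2 e2] := g2 al.
by exists (z1, z2); rewrite big_cat /= /copair e1 e2.
Qed.

Lemma strung_big r : uniq r -> (forall l, l \in r -> is_string l) ->
  strung (\big[@gadd k / gzero k]_(l <- r) indec k (p l) (len l)) r.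
Proof.
elim: r => [|l r IH] ur yr; first by rewrite big_nil; apply: strung_gzero.
rewrite big_cons -cat1s; apply: strung_gadd => //.
  by apply: strung_indec; apply: yr; apply: mem_head.
case/andP: ur => _ ur; apply: IH => // l' l'r.
by apply: yr; rewrite inE l'r orbT.
Qed.

Lemma strung_iso N Y r : strung Y r -> is_ncomplex N Y ->
  (forall m al, \sum_(l <- r | on l m) al l *: y l m = 0 ->
     forall l, l \in r -> on l m -> al l = 0) ->
  (forall m (t : X m), exists al : nat -> k,
     t = \sum_(l <- r | on l m) al l *: y l m) ->
  ncomplex_iso N X Y.
Proof.
move=> [f fP] NY y_free y_span; apply: (@bij_ncomplex_iso k X Y f) => // [m|m t].
  apply: raddf_inj => z fz; have [/(_ z)[al [e i]] _] := fP m.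
  by apply: i; apply: y_free; rewrite -e.
by have [al ->] := y_span m t; have [_ /(_ al)] := fP m.
Qed.

End Strings.

(** * Coordinates on the tensor product *)

Section TensorCoordinates.
Context (k : fieldType) (q : k) (i j : int) (u v : nat).
Context (q0 : q != 0).
Notation L := (indec k i u).
Notation R := (indec k j v).
Notation X := (gtensor q L R).
Notation arr := 'M[k]_(u.+1, v.+1).
Notation ent c a b := (entry a b c).

Definition gen (l : int) (n : nat) (p : int) : indec k l n p := const_mx 1.

Lemma gen_out l n p : ~~ (l <= p <= l + n%:Z) -> gen l n p = 0.
Proof. exact: indec_out. Qed.

Lemma genE l n p (x : indec k l n p) : x = row_sum x *: gen l n p.
Proof. by rewrite {1}[x]row_sumK; apply/rowP => a; rewrite !mxE mulr1. Qed.

Lemma diff_gen l n p : l <= p <= l + n%:Z ->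
  diff (indec k l n) p (gen l n p) = gen l n (p + 1).
Proof.
move=> h; apply/rowP => a; rewrite !mxE /= [in LHS]/indec_dim.
rewrite (eq_bigr (fun=> 1)) => [|b _]; last by rewrite !mxE mul1r.
by rewrite sumr_const card_ord h.
Qed.

(** Making the pure tensor total in p and r, with value 0 in the wrong degree, avoids transport
    along equalities of degrees. *)
Definition tens_unit (m p r : int) : X m :=
  if @idP (p + r == m) is ReflectT h then pure h (gen i u p) (gen j v r) else 0.

Lemma tens_unitE (m p r : int) (h : p + r == m) :
  tens_unit m p r = pure h (gen i u p) (gen j v r).
Proof.
rewrite /tens_unit; case: {-}_ / idP => [h'|/(_ h)//].
by rewrite (bool_irrelevance h' h).
Qed.

Lemma tens_unit_deg m p r : p + r != m -> tens_unit m p r = 0.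
Proof. by rewrite /tens_unit; case: {-}_ / idP => // h /negP. Qed.

Lemma pure0l (m p r : int) (h : p + r == m) (y : R r) : pure h (0 : L p) y = 0.
Proof.
have := @pure_linearl k L R m p r h y (-1) 0 0.
by rewrite scaler0 addr0 scaleN1r addNr.
Qed.

Lemma pure0r (m p r : int) (h : p + r == m) (x : L p) : pure h x (0 : R r) = 0.
Proof.
have := @pure_linearr k L R m p r h x (-1) 0 0.
by rewrite scaler0 addr0 scaleN1r addNr.
Qed.

Lemma pureZl (m p r : int) (h : p + r == m) a (x : L p) (y : R r) :
  pure h (a *: x) y = a *: pure h x y.
Proof.
by have := @pure_linearl k L R m p r h y a x 0; rewrite addr0 pure0l addr0.
Qed.

Lemma pureZr (m p r : int) (h : p + r == m) a (x : L p) (y : R r) :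
  pure h x (a *: y) = a *: pure h x y.
Proof.
by have := @pure_linearr k L R m p r h x a y 0; rewrite addr0 pure0r addr0.
Qed.

Lemma tens_unit_out m p r :
  ~~ ((i <= p <= i + u%:Z) && (j <= r <= j + v%:Z)) -> tens_unit m p r = 0.
Proof.
have [h|h] := boolP (p + r == m); last by rewrite (tens_unit_deg h).
by rewrite (tens_unitE h) negb_and => /orP[/gen_out|/gen_out] ->; rewrite ?pure0l ?pure0r.
Qed.

Lemma diff_tens_unit m p r : (i <= p <= i + u%:Z) -> (j <= r <= j + v%:Z) ->
  diff X m (tens_unit m p r)
  = tens_unit (m + 1) p (r + 1) + q ^ r *: tens_unit (m + 1) (p + 1) r.
Proof.
move=> hp hr; have [h|h] := boolP (p + r == m).
  by rewrite (tens_unitE h) diff_pure !diff_gen // -!tens_unitE.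
by rewrite !tens_unit_deg ?linear0 ?scaler0 ?addr0 //; lia.
Qed.

(* Scaling by powers of q^j removes j from the differential. *)
Definition tens_elt (m : int) (a b : nat) : X m :=
  (q ^ j) ^+ a *: tens_unit m (i + a%:Z) (j + b%:Z).

Lemma tens_elt_outl m b : tens_elt m u.+1 b = 0.
Proof. by rewrite /tens_elt tens_unit_out ?scaler0 //; lia. Qed.

Lemma tens_elt_outr m a : tens_elt m a v.+1 = 0.
Proof. by rewrite /tens_elt tens_unit_out ?scaler0 //; lia. Qed.

Lemma diff_tens_elt m a b : (a <= u)%N -> (b <= v)%N ->
  diff X m (tens_elt m a b)
  = tens_elt (m + 1) a b.+1 + q ^+ b *: tens_elt (m + 1) a.+1 b.
Proof.
move=> au bv; rewrite /tens_elt linearZ /= diff_tens_unit; try lia.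
have Sz n : n.+1%:Z = n%:Z + 1 by lia.
rewrite scalerDr !scalerA expfzDr // !Sz !addrA; congr (_ + _ *: _).
by rewrite exprS -exprnP; ring.
Qed.

Definition realize m (c : arr) : X m :=
  \sum_(a < u.+1) \sum_(b < v.+1) ent c a b *: tens_elt m a b.

Fact realize_linear m : linear (realize m).
Proof.
move=> t c d; rewrite /realize scaler_sumr -big_split; apply: eq_bigr => a _.
rewrite scaler_sumr -big_split; apply: eq_bigr => b _.
by rewrite entD entZ scalerDl scalerA.
Qed.
HB.instance Definition _ m :=
  GRing.isLinear.Build k arr (X m) *:%R (realize m) (realize_linear m).

Lemma sum_shift (V : lmodType k) n (x : nat -> k) (z : nat -> V) : z n.+1 = 0 ->
  \sum_(b < n.+1) x b *: z b.+1
  = \sum_(b < n.+1) (if b : nat is b'.+1 then x b' else 0) *: z b.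
Proof.
move=> zn; rewrite big_ord_recr [RHS]big_ord_recl /= zn scaler0 scale0r addr0 add0r.
by apply: eq_bigr.
Qed.

(** Both terms of the differential shift an index by one; the vectors pushed past u or v are zero,
    which matches the empty first row or column in [raise]. *)
Lemma diff_realize m c : diff X m (realize m c) = realize (m + 1) (raise q c).
Proof.
rewrite /realize linear_sum.
transitivity (\sum_(a < u.+1) \sum_(b < v.+1) ent c a b *: tens_elt (m + 1) a b.+1
  + \sum_(b < v.+1) \sum_(a < u.+1) (q ^+ b * ent c a b) *: tens_elt (m + 1) a.+1 b).
  rewrite [X in _ = _ + X]exchange_big -big_split; apply: eq_bigr => a _ /=.
  rewrite linear_sum -big_split; apply: eq_bigr => b _ /=.
  by rewrite linearZ /= diff_tens_elt ?leq_ord // scalerDr [_ ^+ b * _]mulrC -scalerA.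
have S1 (a : nat) : \sum_(b < v.+1) ent c a b *: tens_elt (m + 1) a b.+1
    = \sum_(b < v.+1) (if b : nat is b'.+1 then ent c a b' else 0)
        *: tens_elt (m + 1) a b.
  exact: (sum_shift (entry a ^~ c) (tens_elt_outr _ a)).
have S2 (b : nat) : \sum_(a < u.+1) (q ^+ b * ent c a b) *: tens_elt (m + 1) a.+1 b
    = \sum_(a < u.+1) (if a : nat is a'.+1 then q ^+ b * ent c a' b else 0)
        *: tens_elt (m + 1) a b.
  exact: (@sum_shift _ u (fun a => q ^+ b * ent c a b) (tens_elt (m + 1) ^~ b)
            (tens_elt_outl _ b)).
under eq_bigr do rewrite S1.
under [X in _ + X = _]eq_bigr do rewrite S2.
rewrite [X in _ + X = _]exchange_big -big_split; apply: eq_bigr => a _ /=.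
rewrite -big_split; apply: eq_bigr => b _ /=.
rewrite -scalerDl ent_arr_of !leq_ord /=; congr ((_ + _) *: _).
by case: (nat_of_ord a) => //; rewrite mulr0.
Qed.

(** Division by (q^j)^a undoes the scaling in [tens_elt]. *)
Definition coord_fun (m p r : int) (h : p + r == m) (x : L p) (y : R r) : arr :=
  arr_of u v (fun a b => ((p == i + a%:Z) && (r == j + b%:Z))%:R
                     * (row_sum x * row_sum y) / (q ^ j) ^+ a).

Fact coord_linearl m p r (h : p + r == m) (y : R r) :
  linear (fun x : L p => coord_fun h x y).
Proof.
move=> a x x'; apply: entP => s t su tv.
by rewrite entD entZ !ent_arr_of su tv /= row_sumP; ring.
Qed.

Fact coord_linearr m p r (h : p + r == m) (x : L p) :
  linear (fun y : R r => coord_fun h x y).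
Proof.
move=> a y y'; apply: entP => s t su tv.
by rewrite entD entZ !ent_arr_of su tv /= row_sumP; ring.
Qed.

Definition coord m : X m -> arr :=
  @tens_lift k L R m arr (BilinFamily (@coord_linearl m) (@coord_linearr m)).
HB.instance Definition _ m := GRing.Linear.on (@coord m).

Lemma coord_pure m p r (h : p + r == m) (x : L p) (y : R r) :
  coord (pure h x y) = coord_fun h x y.
Proof. exact: tens_lift_pure. Qed.

Lemma coordK m : cancel (@coord m) (@realize m).
Proof.
apply: (@tens_ext k L R m (X m) (realize m \o @coord m) idfun).
move=> p r h x y /=; rewrite coord_pure /coord_fun.
have [hp|hp] := boolP (i <= p <= i + u%:Z); last first.
  rewrite (indec_out x hp) pure0l.
  apply: big1 => a _; apply: big1 => b _.
  by rewrite ent_arr_of !leq_ord row_sum0 !(mul0r, mulr0) scale0r.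
have [hr|hr] := boolP (j <= r <= j + v%:Z); last first.
  rewrite (indec_out y hr) pure0r.
  apply: big1 => a _; apply: big1 => b _.
  by rewrite ent_arr_of !leq_ord row_sum0 !(mul0r, mulr0) scale0r.
have [a [au pa]] : exists a, (a < u.+1)%N /\ p = i + a%:Z.
  by exists `|p - i|%N; lia.
have [b [bv rb]] : exists b, (b < v.+1)%N /\ r = j + b%:Z.
  by exists `|r - j|%N; lia.
subst p r.
rewrite /realize (bigD1 (Ordinal au)) //= (bigD1 (Ordinal bv)) //=.
rewrite !big1 ?addr0 => [|a' a'a|b' b'b].
- rewrite ent_arr_of -ltnS au -ltnS bv /= !eqxx mul1r /tens_elt scalerA.
  rewrite divfK ?expf_neq0 ?expfz_neq0 // (tens_unitE h).
  by rewrite [in RHS](genE x) [in RHS](genE y) pureZl pureZr scalerA.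
- apply: big1 => b' _; rewrite ent_arr_of; case: ifP; rewrite ?scale0r // => _.
  have /negbTE na : (a' : nat) != a by exact: a'a.
  rewrite (inj_eq (addrI i)) eqz_nat [X in X && _]eq_sym na.
  by rewrite !mul0r scale0r.
- rewrite ent_arr_of; case: ifP; rewrite ?scale0r // => _.
  have /negbTE nb : (b' : nat) != b by exact: b'b.
  rewrite (inj_eq (addrI j)) eqz_nat [X in _ && X]eq_sym nb.
  by rewrite andbF !mul0r scale0r.
Qed.

Lemma ent_coord_tens_elt m a b a' b' : (a <= u)%N -> (b <= v)%N ->
  (a' <= u)%N -> (b' <= v)%N -> m = i + j + (a + b)%N%:Z ->
  ent (coord (tens_elt m a b)) a' b' = ((a' == a) && (b' == b))%:R.
Proof.
move=> au bv au' bv' me.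
have h : (i + a%:Z) + (j + b%:Z) == m by lia.
rewrite /tens_elt linearZ /= (tens_unitE h) coord_pure entZ ent_arr_of au' bv' /=.
rewrite !row_sum_const /indec_dim.
have hi : i <= i + a%:Z <= i + u%:Z by lia.
have hj : j <= j + b%:Z <= j + v%:Z by lia.
rewrite hi hj !mul1r mulr1 !(inj_eq (addrI _)) !eqz_nat [a == _]eq_sym [b == _]eq_sym.
have [->|_] := eqVneq a' a; last by rewrite !mul0r mulr0.
by rewrite mulrC divfK ?expf_neq0 ?expfz_neq0.
Qed.

(** Homogeneity is essential: [realize m] kills every entry off the antidiagonal of degree d. *)
Lemma realizeK m (d : nat) c : m = i + j + d%:Z -> homog d c ->
  coord (realize m c) = c.
Proof.
move=> md hc; apply: entP => a b au bv; rewrite /realize linear_sum ent_sum.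
have [abd|abd] := eqVneq (a + b)%N d; last first.
  rewrite (hc _ _ abd); apply: big1 => a' _; rewrite linear_sum ent_sum.
  apply: big1 => b' _; rewrite linearZ /= entZ.
  have [abd'|/hc->] := eqVneq (a' + b')%N d; last by rewrite mul0r.
  rewrite ent_coord_tens_elt ?leq_ord // ?abd' //.
  rewrite (_ : (a == a') && (b == b') = false) ?mulr0 //.
  by apply/negP => /andP[/eqP aa /eqP bb]; rewrite aa bb abd' eqxx in abd.
have H (a' : 'I_u.+1) (b' : 'I_v.+1) :
    ent (coord (ent c a' b' *: tens_elt m a' b')) a b
    = ent c a' b' * ((a == a') && (b == b'))%:R.
  rewrite linearZ /= entZ.
  have [abd'|/hc->] := eqVneq (a' + b')%N d; last by rewrite !mul0r.
  by rewrite ent_coord_tens_elt ?leq_ord // abd'.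
rewrite (bigD1 (inord a)) //= linear_sum ent_sum (bigD1 (inord b)) //= H !inordK //.
rewrite !eqxx mulr1 !big1 ?addr0 // => [a' a'a|b' b'b].
  rewrite linear_sum ent_sum big1 // => b' _; rewrite H.
  case: eqP => [e|]; last by rewrite mulr0.
  by rewrite e inord_val eqxx in a'a.
have := H (inord a) b'; rewrite inordK // => ->.
case: (b =P b') => [e|]; last by rewrite andbF mulr0.
by rewrite e inord_val eqxx in b'b.
Qed.

Lemma realize_proj m (d : nat) c : m = i + j + d%:Z ->
  realize m (proj d c) = realize m c.
Proof.
move=> md; apply: eq_bigr => a _; apply: eq_bigr => b _.
rewrite ent_arr_of !leq_ord /=; case: eqP => // abd.
by rewrite scale0r /tens_elt tens_unit_deg ?scaler0 //; lia.
Qed.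

Lemma realize_low m c : m < i + j -> realize m c = 0.
Proof.
move=> mij; apply: big1 => a _; apply: big1 => b _.
by rewrite /tens_elt tens_unit_deg ?scaler0 //; lia.
Qed.

End TensorCoordinates.

(** * Decomposition of the tensor product *)

Section Decomposition.
Context (k : fieldType) (N : nat) (q : k) (hq : N.-primitive_root q).
Context (i j : int) (u v : nat) (hu : (u < N)%N) (hv : (v < N)%N).
Notation X := (gtensor q (indec k i u) (indec k j v)).
Notation len := (str_len u v N).
Notation on l m := (i + j + l%:Z <= m <= i + j + l%:Z + (len l)%:Z).

(** The absolute value only makes the exponent a natural number; the strings are evaluated in
    degrees m >= i + j + l. *)
Definition tens_string l m : X m :=
  realize q i j m (iter `|(m - (i + j + l%:Z))%R|%N (@raise k q u v) (str_gen q u v N l)).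

Lemma on_act l d : on l (i + j + d%:Z) = act u v N d l.
Proof. by rewrite /act; lia. Qed.

Lemma tens_stringE l d : (l <= d)%N ->
  tens_string l (i + j + d%:Z)
  = realize q i j _ (iter (d - l) (@raise k q u v) (str_gen q u v N l)).
Proof.
move=> ld; rewrite /tens_string.
by have -> : `|(i + j + d%:Z - (i + j + l%:Z))%R|%N = (d - l)%N by lia.
Qed.

Lemma tens_string_is_string l : (l <= minn u v)%N ->
  is_string (fun l => i + j + l%:Z) len tens_string l.
Proof.
move=> luv m lm; rewrite /tens_string diff_realize ?(q_neq0 hq) //.
set s := `|(m - _)%R|%N.
have -> : `|(m + 1 - (i + j + l%:Z))%R|%N = s.+1 by lia.
case: ifPn => // nl; rewrite -iterS (str_gen_eq0 hq) ?linear0 //; lia.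
Qed.

Lemma tensor_iso (Y : gcomplex k) :
  strung (fun l => i + j + l%:Z) len tens_string Y (index_iota 0 (minn u v).+1) ->
  is_ncomplex N Y -> ncomplex_iso N X Y.
Proof.
move=> sY NY; have q0 := q_neq0 hq.
have sumE (d : nat) (al : nat -> k) :
    \sum_(l <- index_iota 0 (minn u v).+1 | on l (i + j + d%:Z))
      al l *: tens_string l (i + j + d%:Z)
    = realize q i j (i + j + d%:Z) (\sum_(l < (minn u v).+1 | act u v N d l)
        al l *: iter (d - l) (@raise k q u v) (str_gen q u v N l)).
  rewrite linear_sum big_mkord; apply: eq_big => [l|l]; first exact: on_act.
  rewrite on_act => dl; rewrite linearZ /= tens_stringE //.
  by case/andP: dl.
(* Below degree i + j everything is zero; the other degrees correspond to an antidiagonal d. *)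
have low (m : int) : m < i + j \/ exists d : nat, m = i + j + d%:Z.
  case: (boolP (m < i + j)) => h; [by left|right].
  by exists `|(m - (i + j))%R|%N; lia.
apply: (strung_iso sY NY) => m.
  move=> al; have [mij _ l _ /=|[d ->]] := low m; first by lia.
  rewrite sumE => /(congr1 (@coord k q i j u v _)).
  rewrite (@realizeK _ _ _ _ _ _ _ _ d) // ?linear0; last first.
    move=> a b ab; rewrite ent_sum big1 // => l /andP[dl _].
    rewrite entZ (homog_iter_raise _ (@homog_str_gen k q u v N l)) ?mulr0 //.
    by rewrite subnK.
  move=> al0 l; rewrite mem_index_iota => /andP[_ lM].
  by rewrite on_act => dl; apply: (str_free hq hu hv al0 (l := Ordinal lM)).
move=> t; have [mij|[d md]] := low m.
  exists (fun=> 0); rewrite -(coordK q0 t) realize_low // big1 // => l.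
  by rewrite scale0r.
subst m; have [al e] := str_span hq hu hv (@homog_proj k u v d (coord t)).
by exists al; rewrite sumE -e realize_proj // coordK.
Qed.

End Decomposition.

Theorem theorem5p2 (k : fieldType) (N : nat) (hN : (0 < N)%N) (q : k)
    (hq : N.-primitive_root q) (hq1 : q != 1) (i j : int) (u v : nat)
    (hu : (u <= N.-1)%N) (hv : (v <= N.-1)%N) :
  ((u + v <= N.-1)%N ->
     ncomplex_iso N (gtensor q (indec k i u) (indec k j v))
       (\big[@gadd k / gzero k]_(0 <= l < (minn u v).+1)
          indec k (i + j + l%:Z) (u + v - 2 * l)%N))
  /\
  (forall e : nat, (u + v = e + N.-1)%N ->
     ncomplex_iso N (gtensor q (indec k i u) (indec k j v))
       (gadd
          (\big[@gadd k / gzero k]_(0 <= l < e.+1)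
             indec k (i + j + l%:Z) N.-1)
          (\big[@gadd k / gzero k]_(e.+1 <= l < (minn u v).+1)
             indec k (i + j + l%:Z) (u + v - 2 * l)%N))).
Proof.
have uN : (u < N)%N by lia.
have vN : (v < N)%N by lia.
have big_nc (r : seq nat) (p : nat -> int) (n : nat -> nat) :
    (forall l, l \in r -> (n l < N)%N) ->
    is_ncomplex N (\big[@gadd k / gzero k]_(l <- r) indec k (p l) (n l)).
  move=> nN; rewrite big_seq; apply: big_ind => [||l lr].
  - exact: gzero_ncomplex.
  - exact: gadd_ncomplex.
  - exact/indec_ncomplex/nN.
have strings (r : seq nat) (n : nat -> nat) : uniq r ->
    (forall l, l \in r -> (l <= minn u v)%N /\ n l = str_len u v N l) ->
    strung (fun l => i + j + l%:Z) (str_len u v N) (@tens_string k N q i j u v)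
      (\big[@gadd k / gzero k]_(l <- r) indec k (i + j + l%:Z) (n l)) r.
  move=> ur rP.
  have -> : \big[@gadd k / gzero k]_(l <- r) indec k (i + j + l%:Z) (n l)
      = \big[@gadd k / gzero k]_(l <- r) indec k (i + j + l%:Z) (str_len u v N l).
    by rewrite [LHS]big_seq [RHS]big_seq; apply: eq_bigr => l /rP[_ ->].
  apply: strung_big => // l /rP[lM _].
  exact: tens_string_is_string.
split=> [uvN|e uve]; apply: tensor_iso => //.
- apply: strings; first exact: iota_uniq.
  (* A full string occurs here only for l = 0 and u + v = N - 1, where both length formulas
     agree. *)
  by move=> l; rewrite mem_index_iota /str_len; case: ifP; lia.
- by apply: big_nc => l; lia.
(* Since max(u,v) <= N - 1, e <= min(u,v), so the range splits at e + 1. *)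
- have -> : index_iota 0 (minn u v).+1
      = index_iota 0 e.+1 ++ index_iota e.+1 (minn u v).+1.
    by rewrite /index_iota -iotaD; congr (iota _ _); lia.
  apply: strung_gadd.
  + rewrite -[X in uniq X](_ : index_iota 0 (minn u v).+1 = _) ?iota_uniq //.
    by rewrite /index_iota -iotaD; congr (iota _ _); lia.
  + apply: strings; first exact: iota_uniq.
    by move=> l; rewrite mem_index_iota /str_len; case: ifP; lia.
  + apply: strings; first exact: iota_uniq.
    by move=> l; rewrite mem_index_iota /str_len; case: ifP; lia.
- apply: gadd_ncomplex; apply: big_nc => l; first by lia.
  by rewrite mem_index_iota; lia.
Qed.
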